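(* For every constant $q>0$ and every integer $k\geq 3$, there exists a constant $C_{q,k}$ (depending only on $q$ and $k$) such that every $(k,0)$-stable graph $G$ with $\alpha(G)\geq |V(G)|/2-q$ has at most $C_{q,k}$ vertices.
   Context: All graphs are finite, simple and undirected. $\alpha(G)$ denotes the independence number of $G$, and $G-S$ denotes the subgraph of $G$ induced on $V(G)\setminus S$. For integers $k>\ell\geq 0$, a graph $G$ is $(k,\ell)$-stable if for every $S\subseteq V(G)$ with $|S|=k$ we have $\alpha(G-S)\geq \alpha(G)-\ell$. *)

(* Defs.v *)
From HB Require Import structures.
From mathcomp Require Import all_boot all_order all_algebra.
From mathcomp Require Import reals.

Set Implicit Arguments.
Unset Strict Implicit.
Unset Printing Implicit Defensive.

Record sgraph := SGraph {
  vertex :> finType;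
  adj : rel vertex;
  adj_sym : symmetric adj;
  adj_irr : irreflexive adj
}.

Definition independent (G : sgraph) (A : {set G}) : bool :=
  [forall x in A, forall y in A, ~~ adj x y].

Definition alpha (G : sgraph) : nat :=
  \max_(A : {set G} | independent A) #|A|.

Section Induced.
Variables (G : sgraph) (A : {set G}).

Definition induced_vertex : finType := {x : G | x \in A}.

Definition induced_adj : rel induced_vertex :=
  fun x y => adj (val x) (val y).

Lemma induced_adj_sym : symmetric induced_adj.
Proof. by move=> x y; apply: adj_sym. Qed.

Lemma induced_adj_irr : irreflexive induced_adj.
Proof. by move=> x; apply: adj_irr. Qed.

Definition induced : sgraph := SGraph induced_adj_sym induced_adj_irr.
End Induced.

Definition del_vertices (G : sgraph) (S : {set G}) : sgraph := induced (~: S).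

(* The bound alpha (G - S) >= alpha G - l is written without subtraction,
   which is truncated on nat. *)
Definition stable (k l : nat) (G : sgraph) : Prop :=
  forall S : {set G}, #|S| = k -> alpha G <= alpha (del_vertices S) + l.

(* Main.v *)
Require Import Defs.
From mathcomp Require Import all_boot all_order all_algebra.
From mathcomp Require Import reals.
From mathcomp Require Import zify lra.
Import Order.TTheory GRing.Theory Num.Theory.
Local Open Scope ring_scope.

(** Deleting edges without raising the independence number keeps stability, so
    G may be taken alpha-critical: for each edge xy some set with more than
    alpha(G) vertices spans only the edge xy.  Deleting a vertex with its
    neighbourhood spoils every maximum independent set, so all degrees are at
    least 3.  It remains to bound an alpha-critical graph of minimum degree 3
    in terms of d, where |V| <= 2 alpha + d; this is a finiteness theorem of
    Lovasz, and the proof below is by submodularity.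

    Fix a maximum independent set A and let N_A(Y) be the set of neighbours in
    A of a set Y of vertices outside A.  The surplus h(Y) = |N_A(Y)| - |Y| is
    submodular.  It is nonnegative on independent Y, by maximality of A
    (surplus_ge0), and at least -d on every Y, by Hall's condition for A, which
    stability provides (surplus_ge).

    Edges outside A.  If h(Y) < 0 then Y spans an edge.  Branching on the ends
    of such an edge of a minimal minimiser raises the minimum of h each time, so
    there is a set W of at most 2 ^ (d + 1) vertices such that every such Y
    spans an edge with both ends in W (conflict_kernel).  By criticality, every
    edge outside A then has its ends in W (conflicts_few).

    Edges between A and the other vertices. Let v lie outside A and W. For
    each of three neighbours b of v, criticality of vb yields an independent Y
    containing v, with h(Y) = h(Y - v) = 0, in which b is the one neighbour in
    A that v adds (critical_private). If there are many such v, then many of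
    them have the same three traces of Y on W. The independent sets of surplus
    0 with a prescribed trace form a lattice, because conflicts happen inside
    W only (tracedUI). Each of these three lattices separates two vertices u,
    v in at least one direction, so two of the three agree on the direction,
    and Ramsey's theorem gives d + 2 vertices v_1, v_2, ... and two lattices
    such that, for all s < t, both lattices have a member that contains v_s
    and not v_t. Add the v_s one by one to growing members P and Q of the two
    lattices. As v_s gets a single new neighbour from P, and a different one
    from Q, it gets none from the union of P and Q, so h of the union drops by
    1 at each step, while it never rises in between (surplus_setU_anti). It
    starts at a value <= 0 and stays at least -d, a contradiction
    (chain_size). *)

Set Implicit Arguments.
Unset Strict Implicit.
Unset Printing Implicit Defensive.

Local Open Scope nat_scope.

(** * Pigeonhole and Ramsey *)

Lemma pigeonhole (T C : finType) (f : T -> C) (S : {set T}) (D : {pred C}) M :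
    {in S, forall x, f x \in D} -> #|D| * M < #|S| ->
  exists2 c, c \in D & M < #|[set x in S | f x == c]|.
Proof.
move=> fD; rewrite ltnNge => /negP DM.
case: (boolP [exists c in D, M < #|[set x in S | f x == c]|]).
  by case/exists_inP=> c; exists c.
rewrite negb_exists_in => /forall_inP small; case: DM.
rewrite -sum1_card (partition_big f (mem D)) //= -sum_nat_const.
apply: leq_sum => c /small; rewrite -leqNgt -sum1_card.
by rewrite (eq_bigl (fun i => (i \in S) && (f i == c))) // => i; rewrite inE.
Qed.

Lemma pairwise_rev (T : Type) (r : rel T) s :
  pairwise r (rev s) = pairwise (fun x y => r y x) s.
Proof.
elim: s => //= x s IHs; rewrite rev_cons pairwise_rcons IHs.
by rewrite all_rev.
Qed.

(** Ramsey's theorem for lists, with a target length for each colour: fix a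
    vertex, keep those joined to it by the most frequent colour c, and lower the
    target of c.  The relations R c need not be symmetric; a pair is oriented
    from the vertex that was fixed first. *)
Lemma ramsey_weighted (T C : finType) (c0 : C) (R : C -> rel T) (f : C -> nat)
    (S : {set T}) :
    {in S &, forall u v, u != v -> exists c, R c u v} ->
    #|C|.+1 ^ (\sum_c f c) <= #|S| ->
  exists c s, [/\ size s = f c, {subset s <= S} & pairwise (R c) s].
Proof.
move: {2}(\sum_c f c) (erefl (\sum_c f c)) => k.
elim: k f S => [|k IHk] f S sumf Rtot cardS.
  exists c0, [::]; split=> //; apply/esym/eqP.
  by rewrite -leqn0 -sumf (bigD1 c0) //= leq_addr.
have [x xS]: exists x, x \in S.
  by apply/set0Pn; rewrite -card_gt0 (leq_trans _ cardS) // expn_gt0.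
have Rx y : exists c, (y \in S :\ x) ==> R c x y.
  case yS: (y \in S :\ x); last by exists c0.
  move: yS; rewrite in_setD1 => /andP[nyx yS].
  by have [|c Rc] := Rtot x y xS yS; [rewrite eq_sym | exists c].
have [col colP] := fin_all_exists Rx.
have [||c _ cardc] := @pigeonhole _ _ col (S :\ x) predT (#|C|.+1 ^ k).-1;
  first by [].
  have := cardsD1 x S; rewrite xS.
  rewrite [#|predT|](_ : _ = #|C|) //; move: cardS; rewrite sumf expnS.
  have: 0 < #|C| by apply/card_gt0P; exists c0.
  have: 0 < #|C|.+1 ^ k by rewrite expn_gt0.
  by case: (_ ^ k) => // n _ /=; nia.
set S' := [set y in S :\ x | col y == c] in cardc.
have S'S : {subset S' <= S} by move=> y; rewrite !inE => /andP[/andP[]].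
have S'R y : y \in S' -> R c x y.
  by rewrite inE => /andP[yS /eqP <-]; apply: (implyP (colP y)).
case fc: (f c) => [|n]; first by exists c, [::].
pose f' b := if b == c then n else f b.
have sumf' : \sum_b f' b = k.
  apply/eqP; rewrite -eqSS -sumf (bigD1 c) //= [\sum_c f c](bigD1 c) //= fc.
  rewrite /f' eqxx addSn; apply/eqP; congr (_ + _).+1.
  by apply: eq_bigr => b /negPf->.
have [|||b [s [size_s sS' Rs]]] := IHk f' S'; first by [].
- by move=> u v /S'S uS /S'S; apply: Rtot.
- by rewrite sumf'; case: (_ ^ k) cardc.
case: (eqVneq b c) => [ebc|nbc]; last first.
  exists b, s; split=> //; first by rewrite size_s /f' (negPf nbc).
  by move=> y /sS'/S'S.
exists b, (x :: s); split=> /=.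
- by rewrite size_s /f' ebc eqxx fc.
- by move=> y; rewrite inE => /orP[/eqP->|/sS'/S'S].
- by rewrite Rs andbT; apply/allP=> y /sS'/S'R; rewrite ebc.
Qed.

Lemma ramsey (T C : finType) (c0 : C) (R : C -> rel T) m (S : {set T}) :
    {in S &, forall u v, u != v -> exists c, R c u v} ->
    #|C|.+1 ^ (#|C| * m) <= #|S| ->
  exists c s, [/\ size s = m, {subset s <= S} & pairwise (R c) s].
Proof.
move=> Rtot cardS; apply: (ramsey_weighted (f := fun=> m) c0) => //.
by rewrite sum_nat_const.
Qed.

(** * Independent sets avoiding three vertices *)

Section CriticalGraph.

Variables (T : finType) (e : rel T) (a d : nat).
Implicit Types X Y Z : {set T}.

(** Independence for a bare relation, so that edges can be deleted while the
    vertex type stays the same. *)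
Definition indep (X : {set T}) := [forall x in X, forall y in X, ~~ e x y].

Definition nbr (X : {set T}) := [set y | [exists x in X, e x y]].

Hypothesis e_sym : symmetric e.
Hypothesis e_irr : irreflexive e.
Hypothesis indep_le : forall X, indep X -> #|X| <= a.
Hypothesis avoid3 : forall S : {set T}, #|S| <= 3 ->
  exists J, [/\ indep J, #|J| = a & [disjoint J & S]].
Hypothesis critical : forall x y, e x y -> exists J : {set T},
  [/\ a < #|J|, x \in J, y \in J &
      {in J &, forall u v, e u v -> [set u; v] = [set x; y]}].
Hypothesis card_le : #|T| <= 2 * a + d.

Lemma indepP X : reflect {in X &, forall x y, ~~ e x y} (indep X).
Proof.
apply: (iffP forall_inP) => [h x y xX yX | h x xX].
  by have /forall_inP/(_ y yX) := h x xX.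
by apply/forall_inP=> y; apply: h.
Qed.

Lemma nbrP X y : reflect (exists2 x, x \in X & e x y) (y \in nbr X).
Proof. by rewrite inE; apply: exists_inP. Qed.

Lemma indep_sub X Y : X \subset Y -> indep Y -> indep X.
Proof.
move=> /subsetP sXY /indepP iY; apply/indepP=> x y /sXY xY /sXY.
exact: iY.
Qed.

Lemma nbrS X Y : X \subset Y -> nbr X \subset nbr Y.
Proof.
move=> /subsetP sXY; apply/subsetP=> y /nbrP[x /sXY xY exy].
by apply/nbrP; exists x.
Qed.

Lemma nbrU X Y : nbr (X :|: Y) = nbr X :|: nbr Y.
Proof.
apply/eqP; rewrite eqEsubset subUset !nbrS ?subsetUl ?subsetUr // !andbT.
apply/subsetP=> y /nbrP[x]; rewrite !in_setU => /orP[] xX exy.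
  by apply/orP; left; apply/nbrP; exists x.
by apply/orP; right; apply/nbrP; exists x.
Qed.

Lemma indep_disjoint_nbr X Y : indep Y -> X \subset Y -> [disjoint Y & nbr X].
Proof.
move=> /indepP iY /subsetP sXY; rewrite disjoint_subset; apply/subsetP=> y yY.
apply/negP=> /nbrP[x /sXY xY]; exact/negP/iY.
Qed.

Lemma indep_setU X Y :
  indep X -> indep Y -> [disjoint Y & nbr X] -> indep (X :|: Y).
Proof.
move=> /indepP iX /indepP iY dXY; apply/indepP=> x y.
have nXY u v : u \in X -> v \in Y -> ~~ e u v.
  move=> uX vY; apply/negP=> euv; have /negP[] := disjointFr dXY vY.
  by apply/nbrP; exists u.
rewrite !in_setU => /orP[] xXY /orP[] yXY; first exact: iX.
- exact: nXY.
- by rewrite e_sym nXY.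
- exact: iY.
Qed.

(** For a smallest counterexample X, choose x in X and a maximum independent J
    that avoids x.  The set X :&: J satisfies the bound, so exchanging the
    neighbours of X in J for the rest of X would enlarge J. *)
Lemma hall_indep X : indep X -> #|X| <= #|nbr X|.
Proof.
have [n leXn] := ubnP #|X|; elim: n X leXn => // n IHn X leXn iX.
have [->|[x xX]] := set_0Vmem X; first by rewrite cards0.
have [|J [iJ cardJ dJx]] := avoid3 (S := [set x]); first by rewrite cards1.
have xJ : x \notin J.
  by rewrite (disjointFl dJx) // set11.
have YltX : #|X :&: J| < #|X|.
  apply: proper_card; rewrite properE subsetIl; apply/subsetPn.
  by exists x => //; rewrite inE (negPf xJ) andbF.
have leY : #|X :&: J| <= #|nbr (X :&: J)|.
  apply: IHn; first exact: leq_trans YltX _.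
  by apply: indep_sub iX; apply: subsetIl.
have dX : [disjoint X & nbr X] by apply: indep_disjoint_nbr.
have cardJ' : #|X :|: (J :\: nbr X)| <= a.
  apply/indep_le/indep_setU => //.
    by apply: indep_sub iJ; apply: subsetDl.
  by rewrite disjoints_subset; apply/subsetP=> y; rewrite !inE => /andP[].
have := cardsUI X (J :\: nbr X).
have -> : X :&: (J :\: nbr X) = X :&: J.
  apply/setP=> y; rewrite !in_setI in_setD; case yX: (y \in X) => //=.
  by rewrite (disjointFr dX yX).
have := cardsID (nbr X) J.
have: #|J :&: nbr X| + #|nbr (X :&: J)| <= #|nbr X|.
  rewrite -cardsUI.
  have -> : (J :&: nbr X) :&: nbr (X :&: J) = set0.
    apply/eqP; rewrite setI_eq0 (disjointWl (subsetIl _ _)) //.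
    by apply: indep_disjoint_nbr => //; apply: subsetIr.
  by rewrite cards0 addn0 subset_leq_card // subUset subsetIr nbrS ?subsetIl.
lia.
Qed.

(** A vertex together with its neighbourhood meets every maximum independent
    set. *)
Lemma degree_ge3 v : 2 < #|nbr [set v]|.
Proof.
rewrite ltnNge; apply/negP=> deg2.
have [|J [iJ cardJ dJ]] := avoid3 (S := v |: nbr [set v]).
  by rewrite (leq_trans (leq_card_setU _ _)) // cards1 ltnS.
have [Jv JN] : v \notin J /\ [disjoint J & nbr [set v]].
  split; last by apply: disjointWr dJ; apply: subsetUr.
  by rewrite (disjointFl dJ) // setU11.
have: #|v |: J| <= a.
  apply/indep_le/indep_setU => //.
  by apply/indepP=> x y /set1P-> /set1P->; rewrite e_irr.
by rewrite cardsU1 Jv cardJ add1n ltnn.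
Qed.

(** * The surplus function *)

Section Surplus.

Variable A : {set T}.
Hypothesis A_indep : indep A.
Hypothesis A_card : #|A| = a.

Definition nbrA Y := nbr Y :&: A.

Definition surplus (Y : {set T}) : int := (#|nbrA Y|%:Z - #|Y|%:Z)%R.

Lemma nbrAS X Y : X \subset Y -> nbrA X \subset nbrA Y.
Proof. by move=> sXY; rewrite setSI ?nbrS. Qed.

Lemma nbrAU X Y : nbrA (X :|: Y) = nbrA X :|: nbrA Y.
Proof. by rewrite /nbrA nbrU setIUl. Qed.

Lemma surplus_submod Y Z :
  (surplus (Y :|: Z) + surplus (Y :&: Z) <= surplus Y + surplus Z)%R.
Proof.
have := cardsUI Y Z; have := cardsUI (nbrA Y) (nbrA Z).
have: #|nbrA (Y :&: Z)| <= #|nbrA Y :&: nbrA Z|.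
  by rewrite subset_leq_card // subsetI !nbrAS ?subsetIl ?subsetIr.
by rewrite /surplus nbrAU; lia.
Qed.

Lemma surplus_ge0 Y : Y \subset ~: A -> indep Y -> (0 <= surplus Y)%R.
Proof.
move=> YA iY; have: #|Y :|: (A :\: nbr Y)| <= a.
  apply/indep_le/indep_setU => //.
    by apply: indep_sub A_indep; apply: subsetDl.
  by rewrite disjoints_subset; apply/subsetP=> y; rewrite !inE => /andP[].
have := cardsUI Y (A :\: nbr Y).
have -> : Y :&: (A :\: nbr Y) = set0.
  apply/eqP; rewrite setI_eq0 disjoints_subset (subset_trans YA) //.
  by rewrite setCS subsetDl.
have := cardsID (nbr Y) A; rewrite cards0 /surplus /nbrA setIC; lia.
Qed.

Lemma surplus_ge Y : Y \subset ~: A -> (- d%:Z <= surplus Y)%R.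
Proof.
move=> YA.
have hallX : #|A :\: nbr Y| <= #|nbr (A :\: nbr Y)|.
  by apply: hall_indep; apply: indep_sub A_indep; apply: subsetDl.
have : nbr (A :\: nbr Y) \subset ~: (A :|: Y).
  apply/subsetP=> y /nbrP[x]; rewrite !inE => /andP[xY xA] exy.
  apply/norP; split.
    by apply: contraL exy => yA; apply: (indepP _ A_indep).
  apply: contra xY => yY; apply/exists_inP; exists y => //.
  by rewrite e_sym.
move=> /subset_leq_card; have := cardsC (A :|: Y); have := cardsUI A Y.
have -> : A :&: Y = set0.
  by apply/eqP; rewrite setI_eq0 disjoint_sym disjoints_subset.
have := cardsID (nbr Y) A; rewrite cards0 /surplus /nbrA (setIC (nbr Y)).
move: hallX card_le; lia.
Qed.

Definition tight Y := [&& Y \subset ~: A, indep Y & surplus Y == 0%R].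

Lemma tightP Y :
  reflect [/\ Y \subset ~: A, indep Y & surplus Y = 0%R] (tight Y).
Proof.
by apply: (iffP and3P) => -[? ? /eqP ?]; split=> //; apply/eqP.
Qed.

(** Submodularity applied to Y and X :|: Z: their intersection is independent,
    hence has nonnegative surplus. *)
Lemma surplus_setU_anti X Y Z :
    tight Y -> X \subset Y ->
  (surplus (Y :|: Z) <= surplus (X :|: Z))%R.
Proof.
case/tightP=> YA iY sY sXY; have := surplus_submod Y (X :|: Z).
have -> : Y :|: (X :|: Z) = Y :|: Z by rewrite setUA (setUidPl sXY).
have: (0 <= surplus (Y :&: (X :|: Z)))%R.
  apply: surplus_ge0; first by rewrite (subset_trans _ YA) // subsetIl.
  by apply: indep_sub iY; apply: subsetIl.
rewrite sY; lia.
Qed.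

(** A branching argument; F collects the vertices forbidden so far.  Take a
    minimiser Y0 of smallest cardinality.  Intersecting with Y0 shows that every
    minimiser contains every vertex of Y0, so forbidding either end of an
    edge inside Y0 raises the minimum of the surplus. *)
Lemma conflict_kernel n (F : {set T}) :
    (forall Y, Y \subset ~: A :\: F -> (- n%:Z <= surplus Y)%R) ->
  exists2 W : {set T}, #|W| + 2 <= 2 ^ n.+1 &
    forall Y, Y \subset ~: A :\: F -> (surplus Y < 0)%R ->
      exists x y, [/\ x \in Y :&: W, y \in Y :&: W & e x y].
Proof.
elim: n F => [|n IHn] F lb.
  exists set0 => [|Y /lb]; [by rewrite cards0 | lia].
pose low Y := (Y \subset ~: A :\: F) && (surplus Y == - n.+1%:Z)%R.
have [Y1 lowY1|nolow] := pickP low; last first.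
  have [Y YF|W Wn WP] := IHn F.
    have := lb Y YF; have := nolow Y; rewrite /low YF /=; lia.
  by exists W => //; rewrite (leq_trans Wn) // leq_exp2l.
have [Y0 /andP[Y0F /eqP sY0] minY0] :=
  arg_minnP (fun Y : {set T} => #|Y|) lowY1.
have: ~~ indep Y0.
  apply/negP=> /surplus_ge0; rewrite sY0 (subset_trans Y0F) ?subsetDl //.
  by move/(_ isT); lia.
case/forall_inPn=> x xY0 /forall_inPn[y yY0 /negPn exy].
have branch z : z \in Y0 ->
    forall Y, Y \subset ~: A :\: (z |: F) -> (- n%:Z <= surplus Y)%R.
  move=> zY0 Y YzF; have YF : Y \subset ~: A :\: F.
    by rewrite (subset_trans YzF) // setDS // subsetUr.
  have zY : z \notin Y.
    by apply/negP=> /(subsetP YzF); rewrite !inE eqxx.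
  have IF : Y :&: Y0 \subset ~: A :\: F by rewrite (subset_trans _ YF) ?subsetIl.
  have UF : Y :|: Y0 \subset ~: A :\: F by rewrite subUset YF.
  have := lb _ YF; have := lb _ UF; have := lb _ IF.
  have := surplus_submod Y Y0; rewrite sY0 => sm lbI lbU.
  (* If Y has minimal surplus, then so has the smaller set Y :&: Y0. *)
  case: (eqVneq (surplus (Y :&: Y0)) (- n.+1%:Z)%R) => [eqI _|]; last first.
    move: sm lbI lbU; move: (surplus Y) (surplus _) (surplus _); clear; lia.
  have := minY0 (Y :&: Y0); rewrite /low IF eqI eqxx => /(_ isT).
  rewrite leqNgt proper_card // properE subsetIr.
  by apply/subsetPn; exists z => //; rewrite inE (negPf zY).
have [W1 cW1 W1P] := IHn _ (branch x xY0).
have [W2 cW2 W2P] := IHn _ (branch y yY0).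
have split_set Y z : Y \subset ~: A :\: F -> z \notin Y ->
    Y \subset ~: A :\: (z |: F).
  move=> /subsetP YF zY; apply/subsetP=> u uY; have := YF u uY.
  by rewrite !inE; case: eqP => // euz; rewrite -euz uY in zY.
exists ([set x; y] :|: (W1 :|: W2)).
  have := leq_of_leqif (leq_card_setU [set x; y] (W1 :|: W2)).
  have := leq_of_leqif (leq_card_setU W1 W2).
  rewrite expnS mul2n -addnn.
  have: #|[set x; y]| <= 2 by rewrite cards2; case: (_ != _).
  lia.
move=> Y YF sY; have [xY|xY] := boolP (x \in Y); last first.
  have [u [v [uW vW euv]]] := W1P Y (split_set _ _ YF xY) sY.
  exists u, v; move: uW vW; rewrite !inE => /andP[-> ->] /andP[-> ->].
  by rewrite !orbT.
have [yY|yY] := boolP (y \in Y); last first.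
  have [u [v [uW vW euv]]] := W2P Y (split_set _ _ YF yY) sY.
  exists u, v; move: uW vW; rewrite !inE => /andP[-> ->] /andP[-> ->].
  by rewrite !orbT.
by exists x, y; rewrite !inE xY yY !eqxx !orbT.
Qed.

(** For an edge xy outside A, the part outside A of its critical set has
    negative surplus and spans no edge but xy, so xy is the edge found in W. *)
Lemma conflicts_few : exists2 W : {set T}, #|W| + 2 <= 2 ^ d.+1 &
  forall x y, x \notin A -> y \notin A -> e x y -> x \in W.
Proof.
have [|W cardW WP] := @conflict_kernel d set0.
  by move=> Y; rewrite setD0; apply: surplus_ge.
exists W => // x y xA yA exy; have [J [cardJ _ _ Jxy]] := critical exy.
have YA : J :\: A \subset ~: A by apply/subsetP=> z; rewrite !inE => /andP[].
have ND : nbrA (J :\: A) \subset A :\: J.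
  apply/subsetP=> z /setIP[/nbrP[u /setDP[uJ _] euz] zA].
  rewrite in_setD zA andbT; apply/negP=> zJ.
  have := set22 u z; rewrite (Jxy u z uJ zJ euz) => /set2P[] ezx.
    by rewrite ezx (negPf xA) in zA.
  by rewrite ezx (negPf yA) in zA.
have sY : (surplus (J :\: A) < 0)%R.
  have := subset_leq_card ND; have := cardsID A J; have := cardsID J A.
  rewrite setIC /surplus; lia.
have [|u [v [/setIP[uY uW] /setIP[vY vW] euv]]] := WP _ _ sY.
  by rewrite setD0.
have := set21 x y; rewrite -(Jxy u v) //; first by case/set2P=> ->.
  by move: uY; rewrite in_setD => /andP[].
by move: vY; rewrite in_setD => /andP[].
Qed.

(** * Private neighbours and traces *)

(** Since the surplus is 0 with and without v, the vertex v adds exactly one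
    neighbour in A, which has to be b. *)
Definition private v b Y :=
  [/\ v \in Y, tight Y, tight (Y :\ v), b \in nbrA [set v]
    & b \notin nbrA (Y :\ v)].

Lemma private_nbrA v b Y :
  private v b Y -> nbrA [set v] \subset b |: nbrA (Y :\ v).
Proof.
case=> vY /tightP[_ _ sY] /tightP[_ _ sYv] bv bY.
have sN : b |: nbrA (Y :\ v) \subset nbrA Y.
  rewrite subUset sub1set nbrAS ?subsetDl // andbT.
  by apply: (subsetP (nbrAS _)) bv; rewrite sub1set.
have eqN : b |: nbrA (Y :\ v) = nbrA Y.
  apply/eqP; rewrite eqEcard sN cardsU1 bY /=.
  by move: sY sYv; rewrite /surplus (cardsD1 v Y) vY; lia.
by rewrite eqN nbrAS // sub1set.
Qed.

(** Y is the part outside A of the critical set of the edge vb. *)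
Lemma critical_private v b :
  v \notin A -> b \in A -> e v b -> exists Y, private v b Y.
Proof.
move=> vA bA evb; have [J [cardJ vJ bJ Jvb]] := critical evb.
pose Y := J :\: A; pose X := J :&: A; exists Y.
have YA : Y \subset ~: A by apply/subsetP=> z; rewrite !inE => /andP[].
have vY : v \in Y by rewrite in_setD vA.
have Yv_sub : Y :\ v \subset ~: A by rewrite (subset_trans _ YA) ?subsetDl.
have edgeJ u z : u \in J -> z \in J -> e u z -> u \in A -> u = b /\ z = v.
  move=> uJ zJ euz uA; have := Jvb u z uJ zJ euz.
  move=> eqS; have := set21 u z; rewrite eqS => /set2P[euv|eub].
    by rewrite euv (negPf vA) in uA.
  split=> //; have := set21 v b; rewrite -eqS => /set2P[evu|->] //.
  by rewrite evu uA in vA.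
have iY : indep Y.
  apply/indepP=> u z; rewrite !in_setD => /andP[uA uJ] /andP[zA zJ].
  apply/negP=> euz; have := set22 v b; rewrite -(Jvb u z uJ zJ euz).
  by case/set2P=> ebu; [move: uA | move: zA]; rewrite -ebu bA.
have iYv : indep (Y :\ v) by apply: indep_sub iY; apply: subsetDl.
have NY : nbrA Y \subset b |: (A :\: J).
  apply/subsetP=> z /setIP[/nbrP[u /setDP[uJ _] euz] zA].
  rewrite in_setU1 in_setD zA andbT.
  have [zJ|] := boolP (z \in J); last by rewrite orbT.
  rewrite e_sym in euz.
  by have [-> _] := edgeJ z u zJ uJ euz zA; rewrite eqxx.
have NYv : nbrA (Y :\ v) \subset A :\: J.
  apply/subsetP=> z /setIP[/nbrP[u /setD1P[nuv /setDP[uJ _]] euz] zA].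
  rewrite in_setD zA andbT; apply/negP=> zJ.
  rewrite e_sym in euz.
  by have [_ euv] := edgeJ z u zJ uJ euz zA; rewrite euv eqxx in nuv.
have bAJ : b \notin A :\: J by rewrite in_setD bJ.
have [sY sYv] : surplus Y = 0%R /\ surplus (Y :\ v) = 0%R.
  have := surplus_ge0 YA iY; have := surplus_ge0 Yv_sub iYv.
  have := subset_leq_card NY; have := subset_leq_card NYv.
  have := cardsD1 v Y; have := cardsID A J; have := cardsID J A.
  rewrite vY cardsU1 bAJ (setIC A J) A_card -/Y /surplus.
  move: cardJ #|Y| #|Y :\ v| #|nbrA Y| #|nbrA (Y :\ v)| #|A :\: J| #|J :&: A|.
  move: #|J|; clear; lia.
split=> //; first exact/tightP; first exact/tightP.
- by rewrite in_setI bA andbT; apply/nbrP; exists v; rewrite ?set11.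
- by apply: contra bAJ; apply: (subsetP NYv).
Qed.

Section Traces.

Variable W : {set T}.
Hypothesis W_conflicts :
  forall x y, x \notin A -> y \notin A -> e x y -> x \in W.

Definition traced (tr : {set T}) Y := tight Y && (Y :&: W == tr).

(** An edge inside Y :|: Z would have both ends in W, hence in the common trace,
    hence in Y.  So Y :|: Z is independent, and submodularity with nonnegative
    surplus makes both surpluses vanish. *)
Lemma tracedUI tr Y Z :
  traced tr Y -> traced tr Z -> traced tr (Y :|: Z) /\ traced tr (Y :&: Z).
Proof.
case/andP=> /tightP[YA iY sY] /eqP YW /andP[/tightP[ZA iZ sZ] /eqP ZW].
have UA : Y :|: Z \subset ~: A by rewrite subUset YA.
have IA : Y :&: Z \subset ~: A by rewrite (subset_trans _ YA) ?subsetIl.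
have iI : indep (Y :&: Z) by apply: indep_sub iY; apply: subsetIl.
have iU : indep (Y :|: Z).
  have inA u : u \in Y :|: Z -> u \notin A by move/(subsetP UA); rewrite inE.
  have inY u : u \in Y :|: Z -> u \in W -> u \in Y.
    rewrite in_setU => /orP[//|uZ uW].
    suff: u \in Y :&: W by rewrite in_setI => /andP[].
    by rewrite YW -ZW in_setI uZ.
  apply/indepP=> u z uU zU; apply/negP=> euz.
  have uW := W_conflicts (inA _ uU) (inA _ zU) euz.
  have zW : z \in W.
    by apply: (W_conflicts (inA _ zU) (inA _ uU)); rewrite e_sym.
  by move: euz; apply/negP/(indepP _ iY); apply: inY.
have := surplus_submod Y Z; rewrite sY sZ.
have := surplus_ge0 UA iU; have := surplus_ge0 IA iI => geI geU leUI.
have [sU sI] : surplus (Y :|: Z) = 0%R /\ surplus (Y :&: Z) = 0%R.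
  move: geI geU leUI; move: (surplus (Y :|: Z)) (surplus (Y :&: Z)).
  by clear; lia.
split; apply/andP; split.
- exact/tightP.
- by rewrite setIUl YW ZW setUid.
- exact/tightP.
- by rewrite -(setIid W) setIACA YW ZW setIid.
Qed.

Definition separates tr u v :=
  [exists Z : {set T}, [&& traced tr Z, u \in Z & v \notin Z]].

Lemma traced_private_del tr v b Y :
  v \notin W -> private v b Y -> traced tr Y -> traced tr (Y :\ v).
Proof.
move=> vW [_ _ tYv _ _] /andP[_ YW]; rewrite /traced tYv /=.
rewrite -(eqP YW); apply/eqP/setP=> x; rewrite !inE.
by case: eqP => //= ->; rewrite (negPf vW) andbF.
Qed.

(** Removing v from its set Z stays inside the lattice: if Z contains u, then
    Z :\ v separates u from v; otherwise Z separates v from u. *)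
Lemma separates_total tr u v b c Y Z :
    u != v -> v \notin W ->
    private u b Y -> traced tr Y -> private v c Z -> traced tr Z ->
  separates tr u v || separates tr v u.
Proof.
move=> nuv vW [uY _ _ _ _] tY pZ tZ; have [uZ|uZ] := boolP (u \in Z).
  apply/orP; left; apply/existsP; exists (Z :\ v).
  by rewrite (traced_private_del vW pZ tZ) !inE nuv uZ eqxx.
apply/orP; right; apply/existsP; exists Z.
by have [vZ _ _ _ _] := pZ; rewrite tZ vZ uZ.
Qed.

Lemma private_setI tr v b Y Z :
    v \notin W -> private v b Y -> traced tr Y -> traced tr Z -> v \in Z ->
  private v b (Y :&: Z) /\ traced tr (Y :&: Z).
Proof.
move=> vW pY tY tZ vZ; have tYv := traced_private_del vW pY tY.
have [_ tI] := tracedUI tY tZ; have [_ tIv] := tracedUI tYv tZ.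
have delI : (Y :&: Z) :\ v = (Y :\ v) :&: Z by rewrite setIDAC.
have [vY _ _ bv bY] := pY; split=> //; split=> //.
- by rewrite in_setI vY.
- by case/andP: tI.
- by rewrite delI; case/andP: tIv.
- by apply: contra bY; apply: subsetP; rewrite nbrAS // delI subsetIl.
Qed.

Lemma private_avoid tr v b Y s :
    v \notin W -> private v b Y -> traced tr Y -> all (separates tr v) s ->
  exists Z, [/\ private v b Z, traced tr Z & {in s, forall t, t \notin Z}].
Proof.
move=> vW pY tY; elim: s => [_|t s IHs /=]; first by exists Y.
move=> /andP[/existsP[X]] /and3P[tX vX nXt] /IHs[Z [pZ tZ Zs]]; exists (Z :&: X).
have [pI tI] := private_setI vW pZ tZ tX vX; split=> // u.
rewrite inE in_setI negb_and => /predU1P[-> | /Zs ->] //.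
by rewrite nXt orbT.
Qed.

Section Chain.

Variables tr1 tr2 : {set T}.

Definition doubly_private v := v \notin W /\ exists b1 b2 Y1 Y2,
  [/\ b1 != b2, private v b1 Y1, traced tr1 Y1, private v b2 Y2
    & traced tr2 Y2].

(** The vertices of s are added to X1 and X2 one at a time.  Let v be the next
    one, and P, Q the current sets enlarged by what v requires, without v
    itself.  The neighbours of v in A lie in b1 |: nbrA P and in b2 |: nbrA Q;
    as b1 != b2, they all lie in nbrA (P :|: Q), so adding v to P :|: Q lowers
    the surplus by 1. *)
Lemma surplus_chain s X1 X2 :
    {in s, forall v, doubly_private v} ->
    pairwise (separates tr1) s -> pairwise (separates tr2) s ->
    traced tr1 X1 -> traced tr2 X2 ->
    {in s, forall v, v \notin X1 :|: X2} ->
  exists Z1 Z2, [/\ traced tr1 Z1, traced tr2 Z2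
    & (surplus (Z1 :|: Z2) <= surplus (X1 :|: X2) - (size s)%:Z)%R].
Proof.
elim: s X1 X2 => [|v s IHs] X1 X2 good.
  by move=> _ _ t1 t2 _; exists X1, X2; split=> //=; lia.
rewrite !pairwise_cons => /andP[v1 s1] /andP[v2 s2] t1 t2 sX.
have [vW [b1 [b2 [Y1 [Y2 [nb p1 tY1 p2 tY2]]]]]] := good v (mem_head v s).
have [Z1 [pZ1 tZ1 Z1s]] := private_avoid vW p1 tY1 v1.
have [Z2 [pZ2 tZ2 Z2s]] := private_avoid vW p2 tY2 v2.
have [tU1 _] := tracedUI t1 tZ1; have [tU2 _] := tracedUI t2 tZ2.
have [tP _] := tracedUI t1 (traced_private_del vW pZ1 tZ1).
have [tQ _] := tracedUI t2 (traced_private_del vW pZ2 tZ2).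
have [|||||u us|V1 [V2 [tV1 tV2 sV]]] := IHs (X1 :|: Z1) (X2 :|: Z2) => //.
- by move=> u us; apply: good; rewrite inE us orbT.
- have := sX u; rewrite !inE us orbT => /(_ isT); rewrite !negb_or.
  by rewrite (negPf (Z1s u us)) (negPf (Z2s u us)) => /andP[-> ->].
exists V1, V2; split=> //.
set P := X1 :|: (Z1 :\ v) in tP; set Q := X2 :|: (Z2 :\ v) in tQ.
have sPQ : (surplus (P :|: Q) <= surplus (X1 :|: X2))%R.
  have tight1 : tight P by case/andP: tP.
  have tight2 : tight Q by case/andP: tQ.
  have := surplus_setU_anti X2 tight1 (subsetUl _ _).
  have := surplus_setU_anti P tight2 (subsetUl _ _).
  by rewrite (setUC Q) (setUC X2 P); apply: le_trans.
have vPQ : v \notin P :|: Q.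
  have := sX v (mem_head v s); rewrite !inE !negb_or eqxx.
  by move=> /andP[-> ->].
have eqPQ : (X1 :|: Z1) :|: (X2 :|: Z2) = v |: (P :|: Q).
  have [vZ1 _ _ _ _] := pZ1; have [vZ2 _ _ _ _] := pZ2.
  rewrite /P /Q -{1}(setD1K vZ1) -{1}(setD1K vZ2).
  by apply/setP=> x; rewrite !inE; case: (x == v); rewrite ?orbT.
have NPQ : nbrA [set v] \subset nbrA (P :|: Q).
  apply/subsetP=> x xv; rewrite nbrAU in_setU.
  have := subsetP (private_nbrA pZ1) x xv.
  rewrite in_setU1 => /predU1P[xb1|xZ1]; last first.
    by rewrite (subsetP (nbrAS (subsetUr X1 (Z1 :\ v)))).
  have := subsetP (private_nbrA pZ2) x xv.
  rewrite in_setU1 xb1 (negPf nb) /= => xZ2.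
  by rewrite (subsetP (nbrAS (subsetUr X2 (Z2 :\ v))) _ xZ2) orbT.
have : (surplus (v |: (P :|: Q)) = surplus (P :|: Q) - 1)%R.
  rewrite /surplus nbrAU (setUidPr NPQ) cardsU1 vPQ.
  by move: #|_| #|_| => m n; clear; lia.
move: sV sPQ; rewrite eqPQ /=.
move: (surplus (V1 :|: V2)) (surplus (X1 :|: X2)) (surplus (P :|: Q)).
by move: (surplus _) (size s) => h n h1 h2 h3; clear; lia.
Qed.

Lemma chain_size s :
    {in s, forall v, doubly_private v} ->
    pairwise (separates tr1) s -> pairwise (separates tr2) s -> size s <= d.
Proof.
case: s => // v s good s1 s2.
have [vW [b1 [b2 [Y1 [Y2 [_ p1 tY1 p2 tY2]]]]]] := good v (mem_head v s).
have /andP[v1 _] := s1; have /andP[v2 _] := s2.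
have [Z1 [pZ1 tZ1 Z1s]] := private_avoid vW p1 tY1 v1.
have [Z2 [pZ2 tZ2 Z2s]] := private_avoid vW p2 tY2 v2.
have tX1 := traced_private_del vW pZ1 tZ1.
have tX2 := traced_private_del vW pZ2 tZ2.
have [u|V1 [V2 [tV1 tV2 sV]]] := surplus_chain good s1 s2 tX1 tX2.
  rewrite inE => /predU1P[->|us]; first by rewrite !inE eqxx.
  by rewrite !inE (negPf (Z1s u us)) (negPf (Z2s u us)) !andbF.
have /andP[/tightP[V1A _ _] _] := tV1; have /andP[/tightP[V2A _ _] _] := tV2.
have := surplus_ge (Y := V1 :|: V2); rewrite subUset V1A V2A => /(_ isT).
have /andP[/tightP[X1A iX1 sX1] _] := tX1.
have /andP[/tightP[_ _ sX2] _] := tX2.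
have := surplus_submod (Z1 :\ v) (Z2 :\ v); rewrite sX1 sX2.
have := surplus_ge0 (Y := (Z1 :\ v) :&: (Z2 :\ v)).
rewrite (subset_trans (subsetIl _ _) X1A) (indep_sub (subsetIl _ _) iX1).
move=> /(_ isT isT); move: sV => /=.
move: (surplus (V1 :|: V2)) (surplus (Z1 :\ v :|: Z2 :\ v)).
by move: (surplus _) (size s) => h n h1 h2; clear; lia.
Qed.

End Chain.

Lemma private_triple v : v \notin A -> v \notin W ->
  exists (b : {ffun 'I_3 -> T}) (Y : {ffun 'I_3 -> {set T}}),
    injective b /\ forall i, private v (b i) (Y i).
Proof.
move=> vA vW; have deg := degree_ge3 v.
pose b := [ffun i : 'I_3 => nth v (enum (nbr [set v])) i].
have lt_b (i : 'I_3) : i < size (enum (nbr [set v])).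
  by rewrite -cardE (leq_trans (ltn_ord i)).
have binj : injective b.
  move=> i j; rewrite !ffunE => /eqP.
  by rewrite nth_uniq ?lt_b ?enum_uniq // => /eqP/val_inj.
have bP i : exists Y, private v (b i) Y.
  have : b i \in nbr [set v] by rewrite ffunE -mem_enum mem_nth ?lt_b.
  case/nbrP=> _ /set1P-> evb; apply: critical_private => //.
  by apply: contraNT vW => bA; apply: W_conflicts evb.
have [Y YP] := fin_all_exists bP.
exists b, [ffun i => Y i]; split=> // i.
by rewrite [in X in private _ _ X]ffunE.
Qed.

(** The factor (2 ^ #|W|) ^ 3 counts the triples of traces on W.  The number 18
    counts the Ramsey colours: two indices of traces and a direction.  The
    lists have length d + 2, not d + 1, so that even for d = 0 they contain a
    pair, which shows that the two indices differ. *)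
Lemma free_cover_few :
  #|~: A :\: W| <= (2 ^ #|W|) ^ 3 * 19 ^ (18 * d.+2).
Proof.
rewrite leqNgt; apply/negP=> large.
have triple v : exists bY : {ffun 'I_3 -> T} * {ffun 'I_3 -> {set T}},
    v \in ~: A :\: W ->
    injective bY.1 /\ forall i, private v (bY.1 i) (bY.2 i).
  case vAW: (v \in ~: A :\: W); last by exists ([ffun=> v], [ffun=> set0]).
  move: vAW; rewrite in_setD in_setC => /andP[vW vA].
  by have [b [Y bYP]] := private_triple vA vW; exists (b, Y).
have [bY bYP] := fin_all_exists triple.
pose f v : {ffun 'I_3 -> {set T}} := [ffun i => (bY v).2 i :&: W].
have [|| tr _ many] := @pigeonhole _ _ f (~: A :\: W)
    (ffun_on (mem (powerset W))) (19 ^ (18 * d.+2)).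
- by move=> v _; apply/ffun_onP=> i; rewrite ffunE inE subsetIr.
- by rewrite card_ffun_on card_ord card_powerset.
set S := [set v in _ | _] in many.
have SP v : v \in S -> [/\ v \notin W, injective (bY v).1,
    forall i, private v ((bY v).1 i) ((bY v).2 i)
    & forall i, traced (tr i) ((bY v).2 i)].
  rewrite inE => /andP[vAW /eqP fv]; have [binj pY] := bYP v vAW.
  move: vAW; rewrite in_setD => /andP[vW _]; split=> // i.
  have [_ tY _ _ _] := pY i; rewrite /traced tY /=.
  by rewrite -fv ffunE.
pose R (c : 'I_3 * 'I_3 * bool) u v := (c.1.1 != c.1.2) &&
  (if c.2 then separates (tr c.1.1) u v && separates (tr c.1.2) u v
   else separates (tr c.1.1) v u && separates (tr c.1.2) v u).
have [u v uS vS nuv||[[i j] o] [s [size_s sS Rs]]] :=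
    @ramsey T _ (ord0, ord0, true) R d.+2 S.
- have [uW _ pu tu] := SP u uS; have [vW _ pv tv] := SP v vS.
  have tot i := separates_total nuv vW (pu i) (tu i) (pv i) (tv i).
  pose x i := separates (tr i) u v.
  have [i [j [nij xij]]] : exists i j : 'I_3, i != j /\ x i = x j.
    pose i0 : 'I_3 := inord 0; pose i1 : 'I_3 := inord 1.
    pose i2 : 'I_3 := inord 2.
    have n01 : i0 != i1 by rewrite -val_eqE /= !inordK.
    have n02 : i0 != i2 by rewrite -val_eqE /= !inordK.
    have n12 : i1 != i2 by rewrite -val_eqE /= !inordK.
    case: (eqVneq (x i0) (x i1)) => [|x01]; first by exists i0, i1.
    case: (eqVneq (x i0) (x i2)) => [|x02]; first by exists i0, i2.
    by exists i1, i2; move: x01 x02; do 3!case: (x _).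
  exists (i, j, x i); rewrite /R /= nij /=.
  have := tot i; have := tot j; rewrite -/(x i) -/(x j) -xij.
  by case: (x i) => //= -> ->.
- by rewrite !card_prod !card_ord card_bool ltnW.
have dp (l : seq T) : i != j -> {subset l <= S} ->
    {in l, forall v, doubly_private (tr i) (tr j) v}.
  move=> nij lS v /lS/SP[vW binj pv tv]; split=> //.
  exists ((bY v).1 i), ((bY v).1 j), ((bY v).2 i), ((bY v).2 j); split=> //.
  by rewrite (inj_eq binj).
have nij : i != j.
  case: s size_s Rs {sS} => [|w [|w' s]] //= _.
  by case/andP=> /andP[/andP[/= nij _] _] _.
case: o Rs => Rs.
  have [] : pairwise (separates (tr i)) s /\ pairwise (separates (tr j)) s.
    by split; apply: sub_pairwise Rs => u v /and3P[].
  by move=> Ri Rj; have := chain_size (dp s nij sS) Ri Rj; lia.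
have rS : {subset rev s <= S} by move=> v; rewrite mem_rev; apply: sS.
have [] :
    pairwise (separates (tr i)) (rev s) /\ pairwise (separates (tr j)) (rev s).
  by rewrite !pairwise_rev; split; apply: sub_pairwise Rs => u v /and3P[].
move=> Ri Rj; have := chain_size (dp _ nij rS) Ri Rj; rewrite size_rev; lia.
Qed.
End Traces.
End Surplus.

Lemma critical_order_le :
  #|T| <= 2 * (2 ^ d.+1 + (2 ^ 2 ^ d.+1) ^ 3 * 19 ^ (18 * d.+2)).
Proof.
have [|A [iA cardA _]] := avoid3 (S := set0); first by rewrite cards0.
have [W cardW W_conflicts] := conflicts_few iA cardA.
have free := free_cover_few iA cardA W_conflicts.
have leA : #|A| <= #|~: A|.
  apply: leq_trans (hall_indep iA) (subset_leq_card _).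
  by rewrite -disjoints_subset disjoint_sym indep_disjoint_nbr.
have leW : #|W| <= 2 ^ d.+1 by lia.
have free' : #|~: A :\: W| <= (2 ^ 2 ^ d.+1) ^ 3 * 19 ^ (18 * d.+2).
  apply: leq_trans free _; rewrite leq_mul2r; apply/orP; right.
  by rewrite leq_exp2r // leq_exp2l.
have leI : #|~: A :&: W| <= #|W| by rewrite subset_leq_card ?subsetIr.
have := cardsC A; have := cardsID W (~: A).
move: (_ * 19 ^ _) free' => K; lia.
Qed.

End CriticalGraph.

(** * Reduction to critical graphs *)

Lemma critical_spanning_subgraph (T : finType) (e : rel T) (a : nat) :
    symmetric e -> (forall X, indep e X -> #|X| <= a) ->
  exists e' : rel T, [/\ subrel e' e, symmetric e',
    forall X, indep e' X -> #|X| <= a &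
    forall x y, e' x y -> exists J : {set T},
      [/\ a < #|J|, x \in J, y \in J &
          {in J &, forall u v, e' u v -> [set u; v] = [set x; y]}]].
Proof.
have [n] := ubnP #|[set p : T * T | e p.1 p.2]|.
elim: n e => // n IHn e lt_n e_sym le_a.
pose del x y : rel T := fun u v => e u v && ([set u; v] != [set x; y]).
case: (boolP [exists x, exists y, e x y &&
         [forall X : {set T}, indep (del x y) X ==> (#|X| <= a)]]).
  case/existsP=> x /existsP[y /andP[exy /forallP le_del]].
  have [|||e' [sub' sym' le' crit']] := IHn (del x y).
  - rewrite -ltnS; apply: leq_trans lt_n; rewrite ltnS.
    apply/proper_card/properP; split.
      by apply/subsetP=> p; rewrite !inE => /andP[].
    by exists (x, y); rewrite !inE //= /del eqxx andbF.
  - by move=> u v; rewrite /del e_sym setUC.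
  - by move=> X; apply/implyP.
  by exists e'; split=> // u v /sub'/andP[].
rewrite negb_exists => /forallP nodel; exists e; split=> // x y exy.
have := nodel x; rewrite negb_exists => /forallP/(_ y); rewrite exy /=.
case/forallPn=> J; rewrite negb_imply -ltnNge => /andP[/indepP iJ cardJ].
have Jxy : {in J &, forall u v, e u v -> [set u; v] = [set x; y]}.
  move=> u v uJ vJ euv; apply/eqP; have := iJ u v uJ vJ.
  by rewrite /del euv negbK.
have: ~~ indep e J by apply: contraL cardJ => /le_a; rewrite -leqNgt.
case/forall_inPn=> u uJ /forall_inPn[v vJ /negPn euv].
have sJ : [set x; y] \subset J.
  by rewrite -(Jxy u v) //; apply/subsetP=> z /set2P[]->.
by exists J; split=> //; apply: (subsetP sJ); rewrite ?set21 ?set22.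
Qed.

Lemma card_superset (T : finType) (S : {set T}) k : #|S| <= k <= #|T| ->
  exists2 S' : {set T}, S \subset S' & #|S'| = k.
Proof.
case/andP=> leS; rewrite -(subnKC leS); move: (k - #|S|) => n {leS k}.
elim: n => [|n IHn] ltT; first by exists S; rewrite ?addn0.
rewrite addnS in ltT *.
have [S' sS cardS'] := IHn (ltnW ltT).
have [x xS'] : exists x, x \in ~: S'.
  by apply/set0Pn; rewrite -card_gt0; have := cardsC S'; lia.
exists (x |: S'); first by rewrite subsetU // sS orbT.
by move: xS'; rewrite in_setC cardsU1 => ->; rewrite cardS'.
Qed.

Lemma independent_le_alpha (G : sgraph) (X : {set G}) :
  independent X -> #|X| <= alpha G.
Proof. by move=> iX; rewrite /alpha (bigD1 X) //= leq_maxl. Qed.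

Lemma alpha_attained (G : sgraph) :
  exists2 X : {set G}, independent X & #|X| = alpha G.
Proof.
have [|X iX eqX] := @eq_bigmax_cond _ (@independent G) (fun X => #|X|).
  apply/card_gt0P; exists set0.
  by apply/forall_inP=> x; rewrite inE.
by exists X.
Qed.

Lemma stable_avoid (G : sgraph) (k : nat) (S : {set G}) :
    stable k 0 G -> #|S| <= k <= #|G| ->
  exists J : {set G}, [/\ independent J, #|J| = alpha G & [disjoint J & S]].
Proof.
move=> stG /card_superset[S' sSS' cardS'].
have [X iX cardX] := alpha_attained (del_vertices S').
have iJ : independent [set val x | x in X].
  apply/forall_inP=> _ /imsetP[x xX ->].
  apply/forall_inP=> _ /imsetP[y yX ->].
  by have /forall_inP/(_ x xX)/forall_inP/(_ y yX) := iX.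
exists [set val x | x in X]; split=> //.
  apply/eqP; rewrite eqn_leq independent_le_alpha //=.
  rewrite card_imset ?cardX; last exact: val_inj.
  by have := stG _ cardS'; rewrite addn0.
rewrite (disjointWr sSS') // disjoints_subset.
by apply/subsetP=> _ /imsetP[x _ ->]; apply: (valP x).
Qed.

Local Open Scope ring_scope.

Theorem theorem1p4 (R : realType) (q : R) (k : nat) (hq : 0 < q)
    (hk : (3 <= k)%N) :
  exists C : nat, forall G : sgraph,
    stable k 0 G ->
    #|G|%:R / 2%:R - q <= (alpha G)%:R ->
    (#|G| <= C)%N.
Proof.
pose d := (Num.trunc (2 * q)).+1.
exists (maxn k (2 * (2 ^ d.+1 +
    (2 ^ 2 ^ d.+1) ^ 3 * 19 ^ (18 * d.+2))))%N => G stG le_q.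
rewrite leq_max; have [leGk|ltkG] := leqP #|G| k => //=.
have [|e [sub sym le_a crit]] :=
    critical_spanning_subgraph (@adj_sym G) (a := alpha G).
  exact: independent_le_alpha.
apply: critical_order_le sym _ le_a _ crit _.
- by move=> x; apply: contraFF (adj_irr x); apply: sub.
- move=> S leS; have [|J [iJ cardJ dJ]] := stable_avoid stG (S := S).
    by rewrite (leq_trans leS hk) ltnW.
  exists J; split=> //; apply/indepP=> x y xJ yJ; apply/negP=> /sub.
  by apply/negP/(indepP _ _ iJ).
- have lt_d : 2 * q < d%:R by apply: truncnS_gt.
  rewrite -(ler_nat R) natrD natrM; lra.
Qed.
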